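(* Let $X$ be a set, let $\Omega$ be a semigroup, and let $\lambda\in\mathbf{k}$. The triple $\bigl(\mathbf{k}\mathcal{T}(X,\Omega),\diamond,(B^+_\omega)_{\omega\in\Omega}\bigr)$, together with the map $j_X:X\to\mathbf{k}\mathcal{T}(X,\Omega)$, $x\mapsto\langle(1,|),x,(1,|)\rangle$, is the free Rota-Baxter family algebra of weight $\lambda$ on $X$.
   Context: $\mathbf{k}$ is a unitary commutative ring; algebras are unitary associative $\mathbf{k}$-algebras, not necessarily commutative. **Rota-Baxter family algebras.** A Rota-Baxter family of weight $\lambda$ on an algebra $R$ is a collection of linear operators $(P_\omega)_{\omega\in\Omega}$ on $R$ with $P_\alpha(a)P_\beta(b)=P_{\alpha\beta}\bigl(P_\alpha(a)b+aP_\beta(b)+\lambda ab\bigr)$ for all $a,b\in R$, $\alpha,\beta\in\Omega$; then $(R,(P_\omega)_{\omega\in\Omega})$ is a Rota-Baxter family algebra of weight $\lambda$. Morphisms are (unital) algebra morphisms $f$ with $f\circ P_\omega=P'_\omega\circ f$ for all $\omega$. Such an algebra $F$ with a map $i:X\to F$ is free on $X$ if for every Rota-Baxter family algebra $A$ of weight $\lambda$ and every map $g:X\to A$ there is a unique morphism $\bar g:F\to A$ with $\bar g\circ i=g$. **Trees.** Let $\Omega^1$ be $\Omega$ with an identity $1$ adjoined if it has none. $\mathcal{T}(X,\Omega)$ is the set of typed angularly decorated planar rooted trees: planar rooted trees with at least one vertex, where the root and the leaves are edges, each angle (pair of adjacent incoming edges at a vertex) is decorated by an element of $X$, each internal edge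 (neither leaf nor root) is decorated by an element of $\Omega$, leaves are decorated by $1$, and the root edge is undecorated. The symbol $|$ denotes the tree with no vertex ($|\notin\mathcal{T}(X,\Omega)$). Every $T\in\mathcal{T}(X,\Omega)$ is written uniquely as $$T=\langle(\alpha_1,T_1),x_1,(\alpha_2,T_2),x_2,\dots,x_n,(\alpha_{n+1},T_{n+1})\rangle,\quad n\ge0,$$ where the lowest vertex has branches $T_1,\dots,T_{n+1}\in\mathcal{T}(X,\Omega)\sqcup\{|\}$ from left to right, $x_i\in X$ decorates the angle between the $i$-th and $(i+1)$-st incoming edges, and $\alpha_i$ is the type of the edge carrying $T_i$: $\alpha_i\in\Omega$ if $T_i\ne|$, and $\alpha_i=1$ if $T_i=|$. The bracket is extended multilinearly when $T_i\neq |$ is replaced by a linear combination of trees. $\mathbf{k}\mathcal{T}(X,\Omega)$ is the free $\mathbf{k}$-module on $\mathcal{T}(X,\Omega)$. For $\omega\in\Omega$, $B^+_\omega$ is the linear operator on it with $B^+_\omega(T)=\langle(\omega,T)\rangle$ for $T\in\mathcal{T}(X,\Omega)$. **Product.** The depth is $\operatorname{dep}(|)=0$ and $\operatorname{dep}(T)=1+\max_i\operatorname{dep}(T_i)$. The bilinear product $\diamond$ is defined on trees by induction on $\operatorname{dep}(T)+\operatorname{dep}(T')$: for $T=\langle(\alpha_1,T_1),x_1,\dots,x_m,(\alpha_{m+1},T_{m+1})\rangle$ and $T'=\langle(\beta_1,T'_1),y_1,\dots,y_n,(\beta_{n+1},T'_{n+1})\rangle$, $$T\diamond T'=\langle(\alpha_1,T_1),x_1,\dots,x_m,(\gamma,V),y_1,(\beta_2,T'_2),\dots,y_n,(\beta_{n+1},T'_{n+1})\rangle,$$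 where $(\gamma,V)=(1,|)$ if $T_{m+1}=|=T'_1$; $(\gamma,V)=(\alpha_{m+1},T_{m+1})$ if $T_{m+1}\ne|=T'_1$; $(\gamma,V)=(\beta_1,T'_1)$ if $T_{m+1}=|\ne T'_1$; and, if $T_{m+1}\neq|\neq T'_1$, $\gamma=\alpha_{m+1}\beta_1$ and $$V=B^+_{\alpha_{m+1}}(T_{m+1})\diamond T'_1+T_{m+1}\diamond B^+_{\beta_1}(T'_1)+\lambda\,T_{m+1}\diamond T'_1.$$ The unit of $\diamond$ is the one-vertex, one-leaf tree $\langle(1,|)\rangle$. *)

(* Defs.v *)
From HB Require Import structures.
From mathcomp Require Import all_boot all_algebra finmap.
From mathcomp Require Import boolp.

Set Implicit Arguments.
Unset Strict Implicit.
Unset Printing Implicit Defensive.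

Import GRing.Theory.
Local Open Scope ring_scope.

(* Algebras are given as a left module with an explicit product and unit,
   because [algType] would exclude the zero algebra. *)
Section RotaBaxterFamily.
Variables (k : comPzRingType) (Omega : semigroupType) (lam : k).

Record is_algebra (R : lmodType k) (mul : R -> R -> R) (one : R) : Prop := {
  algebra_mulA : associative mul;
  algebra_mul1r : left_id one mul;
  algebra_mulr1 : right_id one mul;
  algebra_linearl : forall v, linear (fun u => mul u v);
  algebra_linearr : forall u, linear (mul u) }.

Record is_rbf_algebra (R : lmodType k) (mul : R -> R -> R) (one : R)
    (P : Omega -> R -> R) : Prop := {
  rbf_algebra : is_algebra mul one;
  rbf_linear : forall w, linear (P w);
  rbf_identity : forall (a b : Omega) (u v : R),
    mul (P a u) (P b v) =
      P (a * b)%g (mul (P a u) v + mul u (P b v) + lam *: mul u v) }.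

Record is_rbf_morphism (R : lmodType k) (mulR : R -> R -> R) (oneR : R)
    (PR : Omega -> R -> R) (S : lmodType k) (mulS : S -> S -> S) (oneS : S)
    (PS : Omega -> S -> S) (f : R -> S) : Prop := {
  rbf_morphism_linear : linear f;
  rbf_morphismM : {morph f : u v / mulR u v >-> mulS u v};
  rbf_morphism1 : f oneR = oneS;
  rbf_morphismP : forall w u, f (PR w u) = PS w (f u) }.

Definition is_free_rbf_algebra (X : Type) (F : lmodType k)
    (mulF : F -> F -> F) (oneF : F) (PF : Omega -> F -> F) (i : X -> F) : Prop :=
  is_rbf_algebra mulF oneF PF /\
  forall (A : lmodType k) (mulA : A -> A -> A) (oneA : A) (PA : Omega -> A -> A),
    is_rbf_algebra mulA oneA PA ->
    forall g : X -> A,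
      exists! f : F -> A,
        is_rbf_morphism mulF oneF PF mulA oneA PA f /\ f \o i =1 g.

End RotaBaxterFamily.

(* Finitely supported functions on [T]. The module [{malg k[T]}] of multinomials
   is the same thing, but it requires [k] to be nonzero. *)
Section FreeModule.
Variables (k : pzRingType) (T : choiceType).

Definition freemod := {fsfun T -> k with 0}.

HB.instance Definition _ := Choice.on freemod.

Implicit Types u v : freemod.

Definition freemod_zero : freemod := [fsfun].
Definition freemod_add u v : freemod :=
  [fsfun t in (finsupp u `|` finsupp v)%fset => u t + v t].
Definition freemod_opp u : freemod := [fsfun t in finsupp u => - u t].
Definition freemod_scale (c : k) u : freemod :=
  [fsfun t in finsupp u => c * u t].

Lemma freemod_zeroE t : freemod_zero t = 0.
Proof. exact: fsfun0E. Qed.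

Lemma freemod_addE u v t : freemod_add u v t = u t + v t.
Proof.
rewrite fsfunE in_fsetU.
by case: (finsuppP u t); case: (finsuppP v t); rewrite //= addr0.
Qed.

Lemma freemod_oppE u t : freemod_opp u t = - u t.
Proof. by rewrite fsfunE; case: finsuppP; rewrite ?oppr0. Qed.

Lemma freemod_scaleE c u t : freemod_scale c u t = c * u t.
Proof. by rewrite fsfunE; case: finsuppP; rewrite ?mulr0. Qed.

Let fE := (freemod_addE, freemod_oppE, freemod_zeroE, freemod_scaleE).

Fact freemod_addA : associative freemod_add.
Proof. by move=> u v w; apply/fsfunP => t; rewrite !fE addrA. Qed.
Fact freemod_addC : commutative freemod_add.
Proof. by move=> u v; apply/fsfunP => t; rewrite !fE addrC. Qed.
Fact freemod_add0 : left_id freemod_zero freemod_add.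
Proof. by move=> u; apply/fsfunP => t; rewrite !fE add0r. Qed.
Fact freemod_addN : left_inverse freemod_zero freemod_opp freemod_add.
Proof. by move=> u; apply/fsfunP => t; rewrite !fE addNr. Qed.

HB.instance Definition _ := GRing.isZmodule.Build freemod
  freemod_addA freemod_addC freemod_add0 freemod_addN.

Fact freemod_scaleA a b u :
  freemod_scale a (freemod_scale b u) = freemod_scale (a * b) u.
Proof. by apply/fsfunP => t; rewrite !fE mulrA. Qed.
Fact freemod_scale1 : left_id 1 freemod_scale.
Proof. by move=> u; apply/fsfunP => t; rewrite !fE mul1r. Qed.
Fact freemod_scaleDr : right_distributive freemod_scale +%R.
Proof. by move=> a u v; apply/fsfunP => t; rewrite !fE mulrDr. Qed.
Fact freemod_scaleDl u : {morph freemod_scale^~ u : a b / a + b}.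
Proof. by move=> a b; apply/fsfunP => t; rewrite !fE mulrDl. Qed.

HB.instance Definition _ := GRing.Zmodule_isLmodule.Build k freemod
  freemod_scaleA freemod_scale1 freemod_scaleDr freemod_scaleDl.

Definition basis (t : T) : freemod := [fsfun s in [fset t]%fset => 1].

Definition linext (M : lmodType k) (f : T -> M) (u : freemod) : M :=
  \sum_(t <- finsupp u) u t *: f t.

End FreeModule.

Section Trees.
Variables (X : Type) (Omega : Type).

(* [Node b1 [:: (x1, b2); ...; (xn, b_n+1)]] is
   < (alpha1, T1), x1, (alpha2, T2), ..., xn, (alpha_n+1, T_n+1) >.
   The branch (alpha, T) is [Edge alpha T] when T is a tree with a vertex, and
   [Leaf] when T = |; in the latter case its type, which is always 1, carries no
   information and is not recorded, so the monoid Omega^1 is not needed. *)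
Inductive tree : Type :=
  | Node of branch & seq (X * branch)
with branch : Type :=
  | Leaf
  | Edge of Omega & tree.

HB.instance Definition _ := gen_eqMixin tree.
HB.instance Definition _ := gen_choiceMixin tree.

Definition dep_branch_with (depT : tree -> nat) (b : branch) : nat :=
  if b is Edge _ T then depT T else 0%N.

Fixpoint dep (T : tree) : nat :=
  let: Node b s := T in
  (foldr (fun p => maxn (dep_branch_with dep p.2)) (dep_branch_with dep b) s).+1.

Definition dep_branch : branch -> nat := dep_branch_with dep.

Definition first_branch (T : tree) : branch := let: Node b _ := T in b.

Definition last_branch (T : tree) : branch :=
  let: Node b s := T in last b (unzip2 s).

(* Merges the lowest vertices of [T] and [T'], the last branch of [T] and the
   first branch of [T'] being together replaced by [c]. *)
Definition graft (T : tree) (c : branch) (T' : tree) : tree :=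
  let: Node b s := T in
  let: Node _ s' := T' in
  if s is p :: s1 then Node b (belast p s1 ++ ((last p s1).1, c) :: s')
  else Node c s'.

Definition Btree (w : Omega) (T : tree) : tree := Node (Edge w T) [::].

Lemma dep_first_branch T : (dep_branch (first_branch T) < dep T)%N.
Proof.
case: T => b s /=; rewrite ltnS.
by elim: s => [|p s IHs] //=; rewrite leq_max IHs orbT.
Qed.

Lemma dep_last_branch T : (dep_branch (last_branch T) < dep T)%N.
Proof.
case: T => b s /=; rewrite ltnS.
elim/last_ind: s => [|s p _] //=.
rewrite /unzip2 map_rcons last_rcons.
elim: s => [|q s IHs] /=; first by rewrite leq_maxl.
by rewrite leq_max IHs orbT.
Qed.

End Trees.

Arguments Leaf {X Omega}.

Section FreeRotaBaxterFamily.
Variables (k : comPzRingType) (X : Type) (Omega : semigroupType).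

Definition ktree : Type := freemod k (tree X Omega).
HB.instance Definition _ := GRing.Lmodule.on ktree.

Definition ktree_basis (T : tree X Omega) : ktree := basis k T.

Definition Bplus (w : Omega) : ktree -> ktree :=
  linext (fun T => ktree_basis (Btree w T)).

Definition ktree_one : ktree := ktree_basis (Node Leaf [::]).

Definition jX (x : X) : ktree := ktree_basis (Node Leaf [:: (x, Leaf)]).

Variable lam : k.

(* The product of two trees, by recursion on a bound [n] on dep T + dep T';
   [tree_diamondE] below is its defining equation. *)
Fixpoint diamond_rec (n : nat) (T T' : tree X Omega) : ktree :=
  match last_branch T, first_branch T' with
  | Leaf, Leaf => ktree_basis (graft T Leaf T')
  | Edge a U, Leaf => ktree_basis (graft T (Edge a U) T')
  | Leaf, Edge b U' => ktree_basis (graft T (Edge b U') T')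
  | Edge a U, Edge b U' =>
      if n is m.+1 then
        linext (fun W => ktree_basis (graft T (Edge (a * b)%g W) T'))
          (diamond_rec m (Btree a U) U' + diamond_rec m U (Btree b U')
           + lam *: diamond_rec m U U')
      else 0
  end.

Definition tree_diamond (T T' : tree X Omega) : ktree :=
  diamond_rec (dep T + dep T') T T'.

Definition diamond (u v : ktree) : ktree :=
  linext (fun T => linext (fun T' => tree_diamond T T') v) u.

Lemma diamond_rec_stable n m T T' :
  (dep T + dep T' <= n)%N -> (dep T + dep T' <= m)%N ->
  diamond_rec n T T' = diamond_rec m T T'.
Proof.
elim: n m T T' => [|n IHn] [|m] T T' //=.
- by rewrite leqn0 addn_eq0; case: T.
- by rewrite leqn0 addn_eq0 => _; case: T.
move=> le_n le_m.
have := dep_last_branch T; have := dep_first_branch T'.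
case: (last_branch T) => [|a U]; case: (first_branch T') => [|b U'] //= lt' lt.
have depB w V : dep (Btree (X := X) (Omega := Omega) w V) = (dep V).+1 by [].
have lt2 p : (dep T + dep T' <= p.+1)%N -> (dep U + (dep U').+1 <= p)%N.
  by move=> le_p; rewrite -ltnS (leq_trans _ le_p) // -addSn leq_add.
have le3 p : (dep T + dep T' <= p.+1)%N -> (dep U + dep U' <= p)%N.
  by move=> /lt2; apply: leq_trans; rewrite leq_add2l leqnSn.
congr linext; congr (_ + _ + _ *: _); apply: IHn; rewrite ?depB.
all: by [rewrite addSnnS; apply: lt2 | apply: lt2 | apply: le3].
Qed.

Lemma tree_diamondE (T T' : tree X Omega) :
  tree_diamond T T' =
  match last_branch T, first_branch T' with
  | Leaf, Leaf => ktree_basis (graft T Leaf T')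
  | Edge a U, Leaf => ktree_basis (graft T (Edge a U) T')
  | Leaf, Edge b U' => ktree_basis (graft T (Edge b U') T')
  | Edge a U, Edge b U' =>
      linext (fun W => ktree_basis (graft T (Edge (a * b)%g W) T'))
        (tree_diamond (Btree a U) U' + tree_diamond U (Btree b U')
         + lam *: tree_diamond U U')
  end.
Proof.
rewrite /tree_diamond.
rewrite (@diamond_rec_stable _ (dep T + dep T').+1) // [LHS]/=.
have := dep_last_branch T; have := dep_first_branch T'.
case: (last_branch T) => [|a U]; case: (first_branch T') => [|b U'] // lt' lt.
have le1 : (dep U + (dep U').+1 <= dep T + dep T')%N by rewrite leq_add // ltnW.
have le2 : (dep (Btree a U) + dep U' <= dep T + dep T')%N.
  by rewrite leq_add // ltnW.
have le3 : (dep U + dep U' <= dep T + dep T')%N by rewrite leq_add // ltnW.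
by congr linext; congr (_ + _ + _ *: _); apply: diamond_rec_stable.
Qed.

End FreeRotaBaxterFamily.

(* Main.v *)
Require Import Defs.
From HB Require Import structures.
From mathcomp Require Import all_boot all_algebra.
From mathcomp Require Import finmap zify boolp.

Set Implicit Arguments.
Unset Strict Implicit.
Unset Printing Implicit Defensive.

Import GRing.Theory.
Local Open Scope ring_scope.

(** A tree is the alternating product of its branches and its angle
    decorations: a leaf branch stands for the unit, a branch of type [w]
    carrying [T] stands for [P w T], and an angle decorated by [x] stands for
    the generator [x].  Two trees are multiplied by concatenating these words;
    only the last branch of the first and the first branch of the second
    interact, and when both are of the form [P w T], the Rota-Baxter identity
    is the rule that rewrites their product as a single [P].

    Everything rests on isolating this local interaction.  [glue f c d] is the
    linear extension of [f] to the product of the branches [c] and [d], so that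
    [T <o> T'] is [glue] applied to the operation of grafting a branch between
    [T] and [T'] ([tree_diamond_glue]).

    The Rota-Baxter identity holds almost by definition, since the product of
    two trees [Btree a U] and [Btree b V] consists of one gluing.

    For associativity, let [T'] be the middle tree.  If it has an angle, the
    two gluings happen at different branches of [T'], and they commute
    ([graftA], [glue_exchange]).  If it is a single branch, associativity
    reduces to that of the product of three branches ([glueA]); the only
    nontrivial case is the classical computation that expands both bracketings
    of [P a U * P b V * P c W] into the same seven triple products, which all
    have a smaller total depth.

    For the universal property, a map [g] from [X] to a Rota-Baxter family
    algebra extends by reading each tree as the word above ([ev]).  This is
    multiplicative because the target satisfies the same rewriting rule
    ([ev_tree_diamond]).  It is the only extension because each tree is
    obtained from the unit and the generators by products and the operators
    ([basis_Node_cons], [rbf_morphism_eq_ev]). *)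

(** * Linear extension from a basis *)

Section LinearExtension.
Variables (k : pzRingType) (T : choiceType).
Implicit Types (M : lmodType k) (u v : freemod k T).

(** Linearity compares vectors with different supports, so the sum defining
    [linext] has to be taken over a common larger support. *)
Lemma linextE M (f : T -> M) u (S : {fset T}) :
  (finsupp u `<=` S)%fset -> linext f u = \sum_(t <- S) u t *: f t.
Proof.
move=> sub; rewrite /linext (big_fset_incl _ sub) // => t _ tNu.
by rewrite fsfun_dflt ?scale0r.
Qed.

Lemma linext_is_linear M (f : T -> M) : linear (linext f).
Proof.
move=> a u v.
pose w : freemod k T := a *: u + v; rewrite -/w.
pose S := (finsupp u `|` finsupp v `|` finsupp w)%fset.
have [Su Sv Sw] :
    [/\ finsupp u `<=` S, finsupp v `<=` S & finsupp w `<=` S]%fset.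
  rewrite /S; split; last exact: fsubsetUr.
    exact: fsubset_trans (fsubsetUl _ _) (fsubsetUl _ _).
  exact: fsubset_trans (fsubsetUr _ _) (fsubsetUl _ _).
rewrite (linextE _ Su) (linextE _ Sv) (linextE _ Sw) scaler_sumr -big_split /=.
apply: eq_bigr => t _.
by rewrite freemod_addE freemod_scaleE scalerDl scalerA.
Qed.

HB.instance Definition _ M (f : T -> M) :=
  GRing.isLinear.Build k (freemod k T) M _ (linext f) (linext_is_linear f).

Lemma linext_basis M (f : T -> M) t : linext f (basis k t) = f t.
Proof.
have sub : (finsupp (basis k t) `<=` [fset t])%fset.
  by apply/fsubsetP => s; rewrite mem_finsupp fsfunE; case: ifP; rewrite ?eqxx.
by rewrite (linextE f sub) big_seq_fset1 fsfunE inE eqxx scale1r.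
Qed.

Lemma eq_linext M (f g : T -> M) : f =1 g -> linext f =1 linext g.
Proof. by move=> eq_fg u; apply: eq_bigr => t _; rewrite eq_fg. Qed.

Lemma freemod_decomposition u : u = linext (@basis k T) u.
Proof.
apply/fsfunP => t; rewrite /linext.
have sumE (s : seq T) (F : T -> freemod k T) :
    (\sum_(r <- s) F r) t = \sum_(r <- s) F r t.
  elim/big_rec2: _ => [|r x y _ <-]; first exact: freemod_zeroE.
  exact: freemod_addE.
rewrite sumE; have [ut|ut] := finsuppP u t.
  rewrite big1_seq // => r /andP[_ ru]; rewrite freemod_scaleE fsfunE inE.
  by case: eqP ut => [->|_ _]; rewrite ?mulr0 // ru.
rewrite (big_fsetD1 t) //= freemod_scaleE fsfunE inE eqxx mulr1.
rewrite big1_seq ?addr0 // => r /andP[_]; rewrite !inE => /andP[rt _].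
by rewrite freemod_scaleE fsfunE inE eq_sym (negPf rt) mulr0.
Qed.

Lemma linear_linext M M' (h : M -> M') (f : T -> M) u :
  linear h -> h (linext f u) = linext (h \o f) u.
Proof.
move=> lh; pose h_lin := GRing.isLinear.Build _ _ _ _ h lh.
pose H : {linear M -> M'} := HB.pack h h_lin.
rewrite /linext -[h]/(H : M -> M') linear_sum.
by apply: eq_bigr => t _; rewrite linearZ.
Qed.

Lemma linear_eq_on_basis M (f g : freemod k T -> M) :
  linear f -> linear g -> (forall t, f (basis k t) = g (basis k t)) -> f =1 g.
Proof.
move=> lf lg fg u; rewrite (freemod_decomposition u) !linear_linext //.
exact: eq_linext.
Qed.

End LinearExtension.

Lemma linext_exchange (k : comPzRingType) (S T : choiceType) (M : lmodType k)
    (h : S -> T -> M) u v :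
  linext (fun s => linext (h s) v) u = linext (fun t => linext (h^~ t) u) v.
Proof.
rewrite /linext; under eq_bigr do rewrite scaler_sumr.
rewrite exchange_big; apply: eq_bigr => t _; rewrite scaler_sumr.
by apply: eq_bigr => s _; rewrite !scalerA mulrC.
Qed.

(** * Grafting of trees *)

Section Trees.
Variables (X Omega : Type).
Implicit Types (T : tree X Omega) (c d b : branch X Omega).

(** Trees and branches are mutually inductive through lists, for which the
    generated induction principles are too weak; here the list of branches is
    consumed from the left, one branch at a time. *)
Lemma tree_branch_ind (P : tree X Omega -> Prop) (Pb : branch X Omega -> Prop) :
  Pb Leaf -> (forall w T, P T -> Pb (Edge w T)) ->
  (forall b, Pb b -> P (Node b [::])) ->
  (forall b x c s, Pb b -> P (Node c s) -> P (Node b ((x, c) :: s))) ->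
  forall T, P T.
Proof.
move=> PbL PbE P1 Pc; fix IH 1 => -[b0 s0].
pose PB b : Pb b := if b is Edge w T then PbE w T (IH T) else PbL.
have : Pb b0 by exact: PB.
elim: s0 b0 => [|[x c] s IHs] b0 Pb0; first exact: P1.
exact: Pc (IHs c (PB c)).
Qed.

Lemma graft_rcons b s x d c b' s' :
  graft (Node b (rcons s (x, d))) c (Node b' s' : tree X Omega) =
  Node b (s ++ (x, c) :: s').
Proof. by case: s => [|p s] //=; rewrite belast_rcons last_rcons. Qed.

Lemma last_branch_rcons b s x c :
  last_branch (Node b (rcons s (x, c)) : tree X Omega) = c.
Proof. by rewrite /= /unzip2 map_rcons last_rcons. Qed.

Lemma last_branch_cat b s x c s' :
  last_branch (Node b (s ++ (x, c) :: s') : tree X Omega) =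
  last_branch (Node c s').
Proof. by rewrite /= /unzip2 map_cat last_cat. Qed.

(** Grafting on the right of a tree sees its last branch: this view exposes
    it, whereas the constructor exposes the first branch. *)
Variant tree_spec : tree X Omega -> Type :=
  | TreeCorolla b : tree_spec (Node b [::])
  | TreeRcons b s x c : tree_spec (Node b (rcons s (x, c))).

Lemma treeP T : tree_spec T.
Proof. by case: T => b s; case/lastP: s => [|s [x c]]; constructor. Qed.

Lemma graft_id T b' : graft T (last_branch T) (Node b' [::]) = T.
Proof.
case: (treeP T) => [b|b s x c] //.
by rewrite last_branch_rcons graft_rcons cats1.
Qed.

(** When the middle tree of a triple product has a single branch, the first
    gluing consumes that branch and puts its result [c] in the same place, where
    the second gluing acts on it. *)
Lemma graftA_corolla T c b d T'' :
  (last_branch (graft T c (Node b [::])) = c) *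
  (graft (graft T c (Node b [::])) d T'' = graft T d T'') *
  (graft T d (graft (Node b [::]) c T'') = graft T d T'').
Proof.
case: T'' => b'' s''; case: (treeP T) => [b0|b0 s x e]; first by [].
have -> : graft (Node b [::]) c (Node b'' s'') = Node c s'' by [].
rewrite !graft_rcons last_branch_cat.
by rewrite cats1 graft_rcons.
Qed.

(** When the middle tree of a triple product has an angle, its first and its
    last branch are distinct, so the two graftings do not interfere. *)
Lemma graftA T c b s' x e d T'' (T' := Node b (rcons s' (x, e))) :
  [/\ last_branch (graft T c T') = last_branch T',
      first_branch (graft T' d T'') = first_branch T' &
      graft (graft T c T') d T'' = graft T c (graft T' d T'')].
Proof.
case: T'' => b'' s''; rewrite {}/T' last_branch_rcons graft_rcons.
case: (treeP T) => [b0|b0 s y f].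
  have graft1 u : graft (Node b0 [::]) c (Node b u) = Node c u by [].
  by rewrite !graft1 last_branch_rcons graft_rcons.
rewrite !graft_rcons -rcons_cons -rcons_cat last_branch_rcons graft_rcons.
by rewrite -catA.
Qed.

End Trees.

(** * The diamond product *)

(** The shape of the right-hand side of the Rota-Baxter identity, as a function
    of one of its two arguments. *)
Lemma linear_rb_sum (k : comPzRingType) (lam : k) (V M : lmodType k)
    (f g h : V -> M) :
  linear f -> linear g -> linear h ->
  linear (fun u => f u + g u + lam *: h u).
Proof.
move=> lf lg lh x u v; rewrite lf lg lh addrACA.
rewrite [lam *: _]scalerDr scalerA mulrC.
by rewrite -scalerA [LHS]addrACA -!scalerDr.
Qed.

(** The seven triple products in the expansion of [P a U * P b V * P c W], in
    the order in which each of the two bracketings produces them. *)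
Lemma rb_sum_reassociate (k : pzRingType) (lam : k) (M : lmodType k)
    (x1 x2 x3 x4 x5 x6 x7 : M) :
  x1 + (x2 + x3 + lam *: x4) + lam *: (x5 + x6 + lam *: x7) =
  x1 + x2 + lam *: x5 + x3 + lam *: (x6 + x4 + lam *: x7).
Proof.
rewrite !scalerDr !addrA.
by rewrite [LHS](ACl (1*2*5*3*6*4*7)).
Qed.

Section Diamond.
Variables (k : comPzRingType) (X : Type) (Omega : semigroupType) (lam : k).
Local Notation tree := (tree X Omega).
Local Notation branch := (branch X Omega).
Local Notation ktree := (ktree k X Omega).
Local Notation basis := (@ktree_basis k X Omega).
Local Notation "u <o> v" := (diamond lam u v) (at level 40, left associativity).
Implicit Types (M : lmodType k) (T U V W : tree) (c d : branch).
Implicit Types (a b p : Omega) (u v w : ktree).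

(** The argument of [P (a * b)] when [P a U * P b V] is rewritten by the
    Rota-Baxter identity. *)
Definition rb_sum a U b V : ktree :=
  tree_diamond lam (Btree a U) V + tree_diamond lam U (Btree b V)
  + lam *: tree_diamond lam U V.

(** The product of two branches is a linear combination of branches; rather
    than a free module on branches, it is given by its image under the linear
    extension of a function [f] into an arbitrary module. *)
Definition glue M (f : branch -> M) (c d : branch) : M :=
  match c, d with
  | Leaf, _ => f d
  | _, Leaf => f c
  | Edge a U, Edge b V =>
      linext (fun W => f (Edge (a * b)%g W)) (rb_sum a U b V)
  end.

Lemma tree_diamond_glue T T' :
  tree_diamond lam T T' =
  glue (fun c => basis (graft T c T')) (last_branch T) (first_branch T').
Proof.
rewrite tree_diamondE /glue.
by case: (last_branch T) => [|a U]; case: (first_branch T').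
Qed.

Lemma eq_glue M (f g : branch -> M) : f =1 g -> glue f =2 glue g.
Proof.
by move=> fg [|a U] [|b V] /=; rewrite ?fg //; apply: eq_linext => W.
Qed.

Lemma glue_Leafr M (f : branch -> M) c : glue f c Leaf = f c.
Proof. by case: c. Qed.

Lemma linear_glue M M' (h : M -> M') (f : branch -> M) c d :
  linear h -> h (glue f c d) = glue (h \o f) c d.
Proof.
move=> lh; case: c => [|a U]; case: d => [|b V] //=.
exact: linear_linext.
Qed.

Lemma glue_exchange M (f : branch -> branch -> M) c d c' d' :
  glue (fun e => glue (f e) c' d') c d =
  glue (fun e' => glue (f^~ e') c d) c' d'.
Proof.
case: c => [|a U]; case: d => [|b V] //=.
by case: c' => [|a' U']; case: d' => [|b' V'] //=; apply: linext_exchange.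
Qed.

Lemma diamond_linearl v : linear (fun u => u <o> v).
Proof. exact: linext_is_linear. Qed.

Lemma diamond_linearr u : linear (diamond lam u).
Proof.
move=> x v w; rewrite /diamond !(linext_exchange _ u).
exact: linext_is_linear.
Qed.

Lemma diamondDl u v w : (u + v) <o> w = u <o> w + v <o> w.
Proof. by have := diamond_linearl w 1 u v; rewrite !scale1r. Qed.
Lemma diamondDr u v w : u <o> (v + w) = u <o> v + u <o> w.
Proof. by have := diamond_linearr u 1 v w; rewrite !scale1r. Qed.
Lemma diamond0l v : 0 <o> v = 0.
Proof. by have := diamond_linearl v (-1) 0 0; rewrite !scaleN1r !addNr. Qed.
Lemma diamond0r u : u <o> 0 = 0.
Proof. by have := diamond_linearr u (-1) 0 0; rewrite !scaleN1r !addNr. Qed.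
Lemma diamondZl x u v : (x *: u) <o> v = x *: (u <o> v).
Proof. by have := diamond_linearl v x u 0; rewrite !addr0 diamond0l addr0. Qed.
Lemma diamondZr x u v : u <o> (x *: v) = x *: (u <o> v).
Proof. by have := diamond_linearr u x v 0; rewrite !addr0 diamond0r addr0. Qed.

Lemma diamond_basis T T' : basis T <o> basis T' = tree_diamond lam T T'.
Proof. by rewrite /diamond !linext_basis. Qed.

Lemma Bplus_basis p T : Bplus p (basis T) = basis (Btree p T).
Proof. exact: linext_basis. Qed.

Lemma Bplus_linear p : linear (@Bplus k X Omega p).
Proof. exact: linext_is_linear. Qed.

Lemma Bplus_diamond_basis a b T T' :
  Bplus a (basis T) <o> Bplus b (basis T') =
  Bplus (a * b)%g (rb_sum a T b T').
Proof. by rewrite !Bplus_basis diamond_basis tree_diamond_glue. Qed.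

Lemma rb_sumE a U b V :
  rb_sum a U b V =
  basis (Btree a U) <o> basis V + basis U <o> basis (Btree b V)
    + lam *: (basis U <o> basis V).
Proof. by rewrite !diamond_basis. Qed.

Lemma rb_linearl a b v :
  linear (fun u => Bplus a u <o> v + u <o> Bplus b v + lam *: (u <o> v)).
Proof.
apply: linear_rb_sum; do ?exact: diamond_linearl.
by move=> x u w; rewrite Bplus_linear diamond_linearl.
Qed.

Lemma rb_linearr a b u :
  linear (fun v => Bplus a u <o> v + u <o> Bplus b v + lam *: (u <o> v)).
Proof.
apply: linear_rb_sum; do ?exact: diamond_linearr.
by move=> x v w; rewrite Bplus_linear diamond_linearr.
Qed.

Lemma Bplus_diamond a b u v :
  Bplus a u <o> Bplus b v =
  Bplus (a * b)%g (Bplus a u <o> v + u <o> Bplus b v + lam *: (u <o> v)).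
Proof.
move: u; apply: linear_eq_on_basis => [x u w|x u w|T].
- by rewrite Bplus_linear diamond_linearl.
- by rewrite rb_linearl Bplus_linear.
move: v; apply: linear_eq_on_basis => [x v w|x v w|T'].
- by rewrite Bplus_linear diamond_linearr.
- by rewrite rb_linearr Bplus_linear.
by rewrite Bplus_diamond_basis rb_sumE -!Bplus_basis.
Qed.

(** Associativity of the product of branches, given associativity of the
    product of trees at smaller depths.  The bound covers the seven triples of
    the Rota-Baxter expansion: in each of them at least one of the three
    branches has lost its bottom edge, whereas [Btree] adds 1 to the depth. *)
Lemma glueA M (f : branch -> M) c1 c2 c3 :
  (forall T1 T2 T3,
     (dep T1 + dep T2 + dep T3 <
        dep_branch c1 + dep_branch c2 + dep_branch c3 + 3)%N ->
     (basis T1 <o> basis T2) <o> basis T3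
       = basis T1 <o> (basis T2 <o> basis T3)) ->
  glue (fun d => glue f d c3) c1 c2 = glue (fun d => glue f c1 d) c2 c3.
Proof.
case: c1 => [|a U]; case: c2 => [|b V]; case: c3 => [|c W] IH //=.
(* Both sides are the image under [f'] of the argument of a single operator
   [P (a * b * c)]; those arguments are what has to be compared. *)
pose f' T := f (Edge (a * b * c)%g T).
transitivity (linext f'
    (linext (fun Z => rb_sum (a * b)%g Z c W) (rb_sum a U b V))).
  by rewrite (linear_linext _ _ (linext_is_linear f')).
transitivity (linext f'
    (linext (fun Z => rb_sum a U (b * c)%g Z) (rb_sum b V c W))); last first.
  rewrite (linear_linext _ _ (linext_is_linear f')) /=.
  by apply: eq_linext => Z; apply: eq_linext => Y; rewrite /f' mulgA.
congr (linext f' _).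
transitivity (Bplus (a * b)%g (rb_sum a U b V) <o> basis W
   + rb_sum a U b V <o> Bplus c (basis W)
   + lam *: (rb_sum a U b V <o> basis W)).
  move: (rb_sum a U b V) => u; move: u.
  apply: linear_eq_on_basis => [||T];
    [exact: linext_is_linear | exact: rb_linearl |].
  by rewrite linext_basis rb_sumE -!Bplus_basis.
transitivity (Bplus a (basis U) <o> rb_sum b V c W
   + basis U <o> Bplus (b * c)%g (rb_sum b V c W)
   + lam *: (basis U <o> rb_sum b V c W)); last first.
  move: (rb_sum b V c W) => u; move: u.
  apply: linear_eq_on_basis => [||T];
    [exact: rb_linearr | exact: linext_is_linear |].
  by rewrite linext_basis rb_sumE -!Bplus_basis.
(* The Rota-Baxter identity, read backwards, turns [Bplus (a * b)] of a sum
   into the product of two trees, to which the depth hypothesis applies. *)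
rewrite -!Bplus_diamond_basis !Bplus_basis !rb_sumE.
rewrite !(diamondDl, diamondDr, diamondZl, diamondZr).
rewrite !IH /dep_branch /=; try lia.
exact: rb_sum_reassociate.
Qed.

Lemma diamondA_basis T T' T'' :
  (basis T <o> basis T') <o> basis T'' = basis T <o> (basis T' <o> basis T'').
Proof.
have [n] := ubnP (dep T + dep T' + dep T'')%N.
elim: n T T' T'' => // n IHn T T' T'' le_n.
rewrite !diamond_basis !tree_diamond_glue.
rewrite (linear_glue _ _ _ (diamond_linearl _)).
rewrite (linear_glue _ _ _ (diamond_linearr _)).
under eq_glue => c do rewrite /= diamond_basis tree_diamond_glue.
under [RHS]eq_glue => c do rewrite /= diamond_basis tree_diamond_glue.
case: (treeP T') le_n => [b|b s x e] le_n.
  transitivity (glue (fun d => glue (fun c => basis (graft T c T'')) d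
                                    (first_branch T'')) (last_branch T) b).
    apply: eq_glue => d; rewrite (graftA_corolla T d b d T'').
    by apply: eq_glue => c; rewrite (graftA_corolla T d b c T'').
  rewrite glueA.
    apply: eq_glue => d; case: T'' {le_n} => b'' s'' /=.
    by apply: eq_glue => c; case: T.
  move=> T1 T2 T3 lt; apply: IHn; apply: leq_trans lt _.
  have := dep_last_branch T; have := dep_first_branch T''.
  rewrite /= in le_n *; rewrite /dep_branch in le_n *; lia.
under eq_glue => c.
  under eq_glue => d.
    have [_ _ ->] := graftA T c b s x e d T''. over.
  have [-> _ _] := graftA T c b s x e c T''. over.
rewrite glue_exchange.
apply: eq_glue => d.
by have [_ -> _] := graftA T d b s x e d T''.
Qed.

Lemma diamondA : associative (diamond lam : ktree -> ktree -> ktree).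
Proof.
move=> u v w; move: u; apply: linear_eq_on_basis => [x u u'|x u u'|T].
- exact: diamond_linearl.
- by rewrite !diamond_linearl.
move: v; apply: linear_eq_on_basis => [x v v'|x v v'|T'].
- by rewrite diamond_linearl diamond_linearr.
- by rewrite diamond_linearr diamond_linearl.
move: w; apply: linear_eq_on_basis => [x w w'|x w w'|T''].
- by rewrite !diamond_linearr.
- exact: diamond_linearr.
by rewrite diamondA_basis.
Qed.

Lemma diamond1l : left_id (ktree_one k X Omega) (diamond lam).
Proof.
apply: linear_eq_on_basis => [||T]; first exact: diamond_linearr.
  by move=> x u v.
rewrite diamond_basis tree_diamond_glue /=.
by case: T => b s.
Qed.

Lemma diamond1r : right_id (ktree_one k X Omega) (diamond lam).
Proof.
apply: linear_eq_on_basis => [||T]; first exact: diamond_linearl.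
  by move=> x u v.
by rewrite diamond_basis tree_diamond_glue glue_Leafr graft_id.
Qed.

Lemma ktree_rbf_algebra :
  is_rbf_algebra lam (diamond lam) (ktree_one k X Omega) (@Bplus k X Omega).
Proof.
split; last exact: Bplus_diamond; last exact: Bplus_linear.
split; [exact: diamondA|exact: diamond1l|exact: diamond1r|..].
- exact: diamond_linearl.
- exact: diamond_linearr.
Qed.

End Diamond.

(** * Evaluation in a Rota-Baxter family algebra *)

Section Evaluation.
Variables (k : comPzRingType) (X : Type) (Omega : semigroupType) (lam : k).
Variables (A : lmodType k) (mulA : A -> A -> A) (oneA : A).
Variable PA : Omega -> A -> A.
Hypothesis rbfA : is_rbf_algebra lam mulA oneA PA.
Variable g : X -> A.
Local Notation tree := (tree X Omega).
Local Notation branch := (branch X Omega).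
Local Notation ktree := (ktree k X Omega).
Local Notation basis := (@ktree_basis k X Omega).
Local Notation "u <o> v" := (diamond lam u v) (at level 40, left associativity).
Local Notation "x ** y" := (mulA x y) (at level 40, left associativity).
Implicit Types (T U V : tree) (c d : branch) (s : seq (X * branch)).

(** Open recursion on [evT] lets [ev] below recurse through the branches while
    remaining structurally recursive on trees only. *)
Definition ev_branch_with (evT : tree -> A) (c : branch) : A :=
  if c is Edge p T then PA p (evT T) else oneA.

Fixpoint ev T : A :=
  let: Node c s := T in
  ev_branch_with ev c **
  foldr (fun q y => g q.1 ** (ev_branch_with ev q.2 ** y)) oneA s.

Definition ev_branch := ev_branch_with ev.

Definition ev_tail s : A :=
  foldr (fun q y => g q.1 ** (ev_branch q.2 ** y)) oneA s.

Let mulAA : associative mulA := algebra_mulA (rbf_algebra rbfA).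
Let mul1A : left_id oneA mulA := algebra_mul1r (rbf_algebra rbfA).
Let mulA1 : right_id oneA mulA := algebra_mulr1 (rbf_algebra rbfA).
Let mulA_linearl := algebra_linearl (rbf_algebra rbfA).
Let mulA_linearr := algebra_linearr (rbf_algebra rbfA).

Lemma ev_Node c s : ev (Node c s) = ev_branch c ** ev_tail s.
Proof. by []. Qed.

Lemma ev_tail_cat s s' : ev_tail (s ++ s') = ev_tail s ** ev_tail s'.
Proof. by elim: s => [|q s IHs] /=; rewrite ?mul1A // IHs !mulAA. Qed.

(** The factor [x] is the value of [T] without its last branch, the part that
    grafting leaves unchanged. *)
Lemma ev_graft T : exists2 x, ev T = x ** ev_branch (last_branch T) &
  forall c d s, ev (graft T c (Node d s)) = x ** ev_branch c ** ev_tail s.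
Proof.
case: (treeP T) => [b|b s x e].
  exists oneA => [|c d s]; first by rewrite ev_Node mul1A mulA1.
  by rewrite mul1A.
exists (ev_branch b ** ev_tail s ** g x) => [|c d s'].
  by rewrite last_branch_rcons ev_Node -cats1 ev_tail_cat /= mulA1 !mulAA.
by rewrite graft_rcons ev_Node ev_tail_cat /= !mulAA.
Qed.

(** The rule by which two branches are multiplied is the Rota-Baxter identity
    of the target, once [ev] is known to be multiplicative on the smaller trees
    inside; the bound allows for the extra edge of [Btree]. *)
Lemma ev_glue c d :
  (forall U V, (dep U + dep V < dep_branch c + dep_branch d + 2)%N ->
     linext ev (tree_diamond lam U V) = ev U ** ev V) ->
  glue lam ev_branch c d = ev_branch c ** ev_branch d.
Proof.
case: c => [|a U]; case: d => [|b V] IH; rewrite /= ?mul1A ?mulA1 //.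
rewrite (rbf_identity rbfA).
transitivity (PA (a * b)%g (linext ev (rb_sum lam a U b V))).
  by rewrite (linear_linext _ _ (rbf_linear rbfA _)).
congr (PA _ _).
rewrite /rb_sum !linearD linearZ /=.
by rewrite !IH /dep_branch /= ?mulA1 //; lia.
Qed.

Lemma ev_tree_diamond T T' :
  linext ev (tree_diamond lam T T') = ev T ** ev T'.
Proof.
have [n] := ubnP (dep T + dep T')%N.
elim: n T T' => // n IHn T T' le_n.
rewrite tree_diamond_glue (linear_glue _ _ _ _ (linext_is_linear ev)).
have [x evT ev_graftT] := ev_graft T.
case: T' le_n => d s le_n.
pose h y := x ** y ** ev_tail s.
have lin_h : linear h.
  by move=> r u v; rewrite /h mulA_linearr mulA_linearl.
transitivity (h (glue lam ev_branch (last_branch T) d)).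
  rewrite (linear_glue _ _ _ _ lin_h); apply: eq_glue => c.
  by rewrite /= linext_basis ev_graftT.
rewrite ev_glue; first by rewrite /h evT ev_Node !mulAA.
move=> U V lt; apply: IHn; apply: leq_trans lt _.
have := dep_last_branch T; have := dep_first_branch (Node d s).
rewrite [first_branch _]/= /dep_branch; lia.
Qed.

Lemma ev_is_rbf_morphism :
  is_rbf_morphism (diamond lam) (ktree_one k X Omega) (@Bplus k X Omega)
    mulA oneA PA (linext ev : ktree -> A).
Proof.
split.
- exact: linext_is_linear.
- move=> u v; move: u; apply: linear_eq_on_basis => [x u w|x u w|T].
  + by rewrite diamond_linearl linearP.
  + by rewrite linearP mulA_linearl.
  move: v; apply: linear_eq_on_basis => [x u w|x u w|T'].
  + by rewrite diamond_linearr linearP.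
  + by rewrite linearP mulA_linearr.
  by rewrite diamond_basis ev_tree_diamond !linext_basis.
- by rewrite linext_basis /= mulA1.
- move=> p; apply: linear_eq_on_basis => [x u w|x u w|T].
  + by rewrite Bplus_linear linearP.
  + by rewrite linearP (rbf_linear rbfA).
  by rewrite Bplus_basis !linext_basis /= mulA1.
Qed.

Lemma ev_jX x : linext ev (jX k Omega x) = g x.
Proof. by rewrite linext_basis /= !mul1A mulA1. Qed.

(** Trees are generated from single branches by multiplication by the
    generators, which is why a morphism is determined by its values on [jX]. *)
Lemma basis_Node_cons b x c s :
  basis (Node b ((x, c) :: s)) =
  basis (Node b [::]) <o> (jX k Omega x <o> basis (Node c s)).
Proof.
rewrite diamond_basis tree_diamond_glue /=.
rewrite diamond_basis tree_diamond_glue /=.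
by rewrite glue_Leafr.
Qed.

Lemma rbf_morphism_eq_ev (f : ktree -> A) :
  is_rbf_morphism (diamond lam) (ktree_one k X Omega) (@Bplus k X Omega)
    mulA oneA PA f ->
  f \o @jX k X Omega =1 g -> f =1 linext ev.
Proof.
move=> [lin_f fM f1 fP] fj.
apply: linear_eq_on_basis => // [|T]; first exact: linext_is_linear.
rewrite linext_basis -/(basis T).
pose Pb c := f (basis (Node c [::])) = ev_branch c.
move: T; apply: (@tree_branch_ind _ _ _ Pb) => [||b Pb_b|b x c s Pb_b Pcs].
- by rewrite /Pb f1.
- by move=> p T fT; rewrite /Pb -Bplus_basis fP fT.
- by rewrite Pb_b /= mulA1.
by rewrite basis_Node_cons !fM Pb_b Pcs [f (jX _ _ _)]fj.
Qed.

End Evaluation.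

Theorem theorem2p10 (k : comPzRingType) (X : Type) (Omega : semigroupType)
    (lam : k) :
  @is_free_rbf_algebra k Omega lam X (ktree k X Omega)
    (@diamond k X Omega lam) (ktree_one k X Omega)
    (@Bplus k X Omega) (@jX k X Omega).
Proof.
split; first exact: ktree_rbf_algebra.
move=> A mulA oneA PA rbfA g; exists (linext (ev mulA oneA PA g)); split.
  by split; [exact: ev_is_rbf_morphism | exact: (ev_jX rbfA)].
move=> f [f_morph fj]; apply: funext => u.
by rewrite (rbf_morphism_eq_ev rbfA f_morph fj).
Qed.
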